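(* Let $L\ge 2$ and $N_{\mathrm{em}}\ge 1$ be integers and $p_{\mathrm{src}}\in[0,1]$. Let $(\bm{v},N,m^N,u^N,x^N)$ be random variables as described in the context, satisfying conditions (A), (B) and (C) of the context. Let $\bm{\nu}=\{\nu_M: M\in\mathcal{M}\}$ be non-negative real constants with $\nu_M=0$ for all $M<Lp_{\mathrm{src}}$. Let $\bm{\xi}=\{\xi_{M,U}: (M,U)\in\mathcal{M}\times\mathcal{U},\ 0\le c(M,U)\le 1\}$ be real constants with $|\xi_{M,U}|\le 1$. Let $\eta_1,\delta_1\ge 0$ satisfy $$\max_{Q\in\mathcal{P}_{\mathcal{M}}:\ \mathbb{E}_{M\sim Q}[\nu_M]\ge \mathbb{E}_{M\sim\mathfrak{b}}[\nu_M]+\delta_1} 2^{-N_{\mathrm{em}}D(Q\|\mathfrak{b})}\le \eta_1,\qquad \mathfrak{b}:=\mathfrak{b}_{L,p_{\mathrm{src}}}.$$ Let $\eta_2\ge 0$ and non-negative numbers $\{\delta_2(N)\}_{N=1,2,\dots}$ satisfy $\exp[-N\delta_2(N)]\le\eta_2$ for all $N\ge1$. Let $H_{PA}(N)$ be a function of $N$ such that for every $N\ge 1$ $$\max_{P\in\mathcal{E}_N} H(X|Y)_{P_{\mathcal{X}\times\mathcal{Y}}}\le H_{PA}(N),$$ where $\mathcal{E}_N:=\mathcal{P}^{N,\bm{\nu},\delta_1}\cap\mathcal{P}^{\bm{\xi},\delta_2(N)}$ (sets defined in the context). Then there exist sets $T(N,y^N)\subseteq\{0,1\}^N$, defined for every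 $N\ge1$ and $y^N\in\mathcal{Y}^N$, such that $$\Pr\{N\ge 1,\ x^N\notin T(N,y^N)\}\le \eta_1+\eta_2,$$ where $y^N=(y_1,\dots,y_N)$ with $y_k:=f_{\mathcal{Y}}(m_k,u_k,x_k)$, and $$\log_2|T(N,y^N)|\le N H_{PA}(N)\quad\text{for all } N\ge1 \text{ and all } y^N\in\mathcal{Y}^N.$$
   Context: For a finite set $\Omega$, $\mathcal{P}_\Omega$ denotes the set of probability mass functions on $\Omega$; for $\omega^n=(\omega_1,\dots,\omega_n)\in\Omega^n$ the type $\tilde P_{\omega^n}\in\mathcal{P}_\Omega$ is $\tilde P_{\omega^n}(\omega)=\frac1n|\{i:\omega_i=\omega\}|$ (for several sequences, $\tilde P_{m^N,u^N,x^N}$ is the type of the sequence of triples $(m_k,u_k,x_k)$). Let $\mathcal{M}=\{0,\dots,L\}$, $\mathcal{U}=\mathcal{X}=\{0,1\}$, $\mathcal{Y}=\{(a,b): a\in\{0,\dots,L-2\},\ b\in\{0,1\}\}$, and $\mathcal{W}=\{(M,U,X)\in\mathcal{M}\times\mathcal{U}\times\mathcal{X}: 0\le M-U-X\le L-2\}$. Let $f_{\mathcal{Y}}(M,U,X):=(M-U-X,\ U\oplus X)$ with $\oplus$ addition mod 2. For $P\in\mathcal{P}_{\mathcal{W}}$, $P_{\mathcal{M}}$, $P_{\mathcal{M}\times\mathcal{U}}$, $P_{\mathcal{X}\times\mathcal{Y}}$ are the distributions of $M$, of $(M,U)$, and of $(X,f_{\mathcal{Y}}(M,U,X))$ when $(M,U,X)\sim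 P$; $H(X|Y)_{P_{\mathcal{X}\times\mathcal{Y}}}$ is the conditional Shannon entropy (base 2) under that joint distribution. $c(M,U):=(M-U)/(L-1)$. $\mathfrak{b}_{L,p}(M):=\binom{L}{M}p^M(1-p)^{L-M}$. $D(\cdot\|\cdot)$ is the Kullback–Leibler divergence (base 2). Random variables: on a common probability space (probability $\Pr$), $\bm{v}=(v_0,\dots,v_L)$ are non-negative integers with $\sum_M v_M=N_{\mathrm{em}}$, $N$ is a non-negative integer, and when $N\ge1$, $m^N\in\mathcal{M}^N$, $u^N\in\mathcal{U}^N$, $x^N\in\mathcal{X}^N$ with $(m_k,u_k,x_k)\in\mathcal{W}$ for all $k$. (A) There is $p_{\mathrm{odd}}\le p_{\mathrm{src}}$ with $\Pr\{\bm{v}\}=\frac{N_{\mathrm{em}}!}{\prod_{M=0}^L v_M!}\prod_{M=0}^L(\mathfrak{b}_{L,p_{\mathrm{odd}}}(M))^{v_M}$. (B) For all $M\in\mathcal{M}$, $\Pr\{N\tilde P_{m^N}(M)\le v_M\mid N\ge1\}=1$. (C) For $N\ge 1$, $\Pr\{x^N\mid N,m^N,u^N\}=\prod_{k=1}^N[c(m_k,u_k)]^{x_k}[1-c(m_k,u_k)]^{1-x_k}$. Sets: $\mathcal{P}^{N,\bm{\nu},\delta_1}:=\{P\in\mathcal{P}_{\mathcal{W}}: \mathbb{E}_{M\sim P_{\mathcal{M}}}[\nu_M]\le \frac{N_{\mathrm{em}}}{N}(\mathbb{E}_{M\sim\mathfrak{b}_{L,p_{\mathrm{src}}}}[\nu_M]+\delta_1)\}$,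 and $\mathcal{P}^{\bm{\xi},\delta_2}:=\{P\in\mathcal{P}_{\mathcal{W}}: \mathbb{E}_{(M,U,X)\sim P}[(X-c(M,U))\xi_{M,U}]\le \frac{\delta_2}{3}+[(\frac{\delta_2}{3})^2+2\delta_2\,\mathbb{E}_{(M,U)\sim P_{\mathcal{M}\times\mathcal{U}}}[c(M,U)(1-c(M,U))\xi_{M,U}^2]]^{1/2}\}$. *)

(* Defs.v *)
From HB Require Import structures.
From mathcomp Require Import all_boot all_order all_algebra.
From mathcomp Require Import all_classical all_reals all_analysis.
Set Implicit Arguments. Unset Strict Implicit. Unset Printing Implicit Defensive.
Import Order.TTheory GRing.Theory Num.Theory.
Local Open Scope ring_scope.

Section Defs.
Variable R : realType.
Variable L : nat.

(* M in {0,...,L}, U in {0,1}, X in {0,1} *)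
Definition Tri := ('I_L.+1 * bool * bool)%type.

Definition inW (t : Tri) : bool :=
  ((t.1.2 : nat) + (t.2 : nat) <= t.1.1)%N && (t.1.1 - t.1.2 - t.2 <= L - 2)%N.

Definition inY (y : nat * bool) : bool := (y.1 <= L - 2)%N.

Definition fY (t : Tri) : nat * bool := ((t.1.1 - t.1.2 - t.2)%N, addb t.1.2 t.2).

Definition cc (M U : nat) : R := (M%:R - U%:R) / (L%:R - 1).

Definition binom (p : R) (M : nat) : R := ('C(L, M))%:R * p ^+ M * (1 - p) ^+ (L - M).

Definition log2 (x : R) : R := ln x / ln 2.

Definition tp (T : eqType) (s : seq T) (a : T) : R := (count_mem a s)%:R / (size s)%:R.

Definition trip (m : seq 'I_L.+1) (u x : seq bool) : seq Tri := zip (zip m u) x.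

Definition isPW (P : {ffun Tri -> R}) : Prop :=
  [/\ forall t, 0 <= P t, \sum_t P t = 1 & forall t, ~~ inW t -> P t = 0].

Definition isPM (Q : {ffun 'I_L.+1 -> R}) : Prop :=
  (forall M, 0 <= Q M) /\ \sum_M Q M = 1.

Definition margM (P : {ffun Tri -> R}) (M : 'I_L.+1) : R :=
  \sum_(t | t.1.1 == M) P t.
Definition margMU (P : {ffun Tri -> R}) (M : 'I_L.+1) (U : bool) : R :=
  \sum_(t | (t.1.1 == M) && (t.1.2 == U)) P t.
Definition PXY (P : {ffun Tri -> R}) (x : bool) (y : nat * bool) : R :=
  \sum_(t | (t.2 == x) && (fY t == y)) P t.
Definition PY (P : {ffun Tri -> R}) (y : nat * bool) : R :=
  \sum_(x : bool) PXY P x y.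

Definition condH (P : {ffun Tri -> R}) : R :=
  - \sum_(a < L - 1) \sum_(b : bool) \sum_(x : bool)
      (let q := PXY P x (nat_of_ord a, b) in
       if q == 0 then 0 else q * log2 (q / PY P (nat_of_ord a, b))).

Definition KL (Q b : 'I_L.+1 -> R) : \bar R :=
  if [exists M, (Q M != 0) && (b M == 0)] then +oo%E
  else (\sum_M (if Q M == 0 then 0 else Q M * log2 (Q M / b M)))%:E.

Definition pow2neg (x : \bar R) : R :=
  match x with EFin r => powR 2 (- r) | _ => 0 end.

Definition Ebin (p : R) (nu : 'I_L.+1 -> R) : R := \sum_(M : 'I_L.+1) binom p M * nu M.

Definition inP1 (Nem N : nat) (psrc : R) (nu : 'I_L.+1 -> R) (d1 : R)
  (P : {ffun Tri -> R}) : Prop :=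
  \sum_M margM P M * nu M <= (Nem%:R / N%:R) * (Ebin psrc nu + d1).

Definition inP2 (xi : 'I_L.+1 -> bool -> R) (d2 : R) (P : {ffun Tri -> R}) : Prop :=
  \sum_t P t * (((t.2 : nat)%:R - cc t.1.1 t.1.2) * xi t.1.1 t.1.2)
  <= d2 / 3 + Num.sqrt ((d2 / 3) ^+ 2 + 2 * d2 *
       \sum_(M : 'I_L.+1) \sum_(U : bool)
          margMU P M U * (cc M U * (1 - cc M U) * xi M U ^+ 2)).

End Defs.

(* Main.v *)
Require Import Defs.
From HB Require Import structures.
From mathcomp Require Import all_boot all_order all_algebra.
From mathcomp Require Import all_classical all_reals all_analysis.
From mathcomp Require Import ring lra zify.
Import Order.TTheory GRing.Theory Num.Theory.
Import numFieldNormedType.Exports.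
Local Open Scope classical_set_scope.
Local Open Scope ring_scope.

(* [T n y] consists of the [x] that, with some [(m, u)] compatible with [y], have
   joint type in E_n.  As E_n is convex, the mean of the types over [x] in
   [T n y] is again in E_n, and its conditional entropy bounds [log2 #|T n y| / n]
   without the usual polynomial factor.  The sequence [x] leaves [T] only if the
   type violates the [nu]-constraint, which by (B) is a large deviation of the
   multinomial [v], or the [xi]-constraint, which is the tail event of
   Bernstein's inequality given [(N, m, u)]. *)

Set Implicit Arguments.
Unset Strict Implicit.

(** The constraints are shaped to be convex: the [nu]-constraint is linear in the type, and the
    [xi]-constraint bounds a linear form by a constant plus the square root of an affine function,
    which is concave. Both therefore survive averaging over any set of sequences.

    The square root is the explicit solution of Bernstein's inequality. With [V] the mean variance,
    [t = d / 3 + sqrt ((d / 3)^2 + 2 d V)] solves [t^2 = 2 d (V + t / 3)], so Bernstein's exponent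
    [t^2 / (2 (V + t / 3))] equals [d]. As [V] depends on [(m, u)] only, the threshold is a constant
    once these are fixed.

    On the multinomial side the bound [eta1] leaves no room for a sum over types.

    Condition (B) holds only almost surely, so its failure is carried as a separate null event. *)

(** * Sums of products over tuples and over count vectors *)

Lemma sum_tuple_prod_zip (R : comPzRingType) (A : Type) (B : finType)
    (F : A * B -> R) (s : seq A) :
  \sum_(x : (size s).-tuple B) \prod_(t <- zip s x) F t =
  \prod_(a <- s) \sum_b F (a, b).
Proof.
elim: s => [|a s IH] /=.
  rewrite big_nil (bigD1 [tuple]) //= big_nil big1 ?addr0 // => x.
  by rewrite tuple0.
rewrite big_cons -IH big_distrl /=.
under [RHS]eq_bigr do rewrite big_distrr /=.
rewrite pair_big /=.
rewrite (reindex (fun p : B * (size s).-tuple B => [tuple of p.1 :: p.2])) /=.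
  by apply: eq_bigr => -[b x] _ /=; rewrite big_cons.
exists (fun x => (thead x, [tuple of behead x])) => [[b x] _|x _] /=.
  by congr pair; apply/val_inj.
by rewrite [RHS]tuple_eta; apply/val_inj.
Qed.

Lemma sum_multinomial (R : numFieldType) (I : finType) (x : I -> R) (n : nat) :
  \sum_(f : {ffun I -> 'I_n.+1} | (\sum_i f i)%N == n)
    \prod_i (x i ^+ f i / (f i)`!%:R) = (\sum_i x i) ^+ n / n`!%:R.
Proof.
(* exponential generating functions: e_i is exp (x_i X) truncated at degree n *)
pose e i : {poly R} := \poly_(j < n.+1) (x i ^+ j / j`!%:R).
have fact_neq0 k : k`!%:R != 0 :> R by rewrite pnatr_eq0 -lt0n fact_gt0.
have coef_e (r : seq I) k : (k <= n)%N ->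
    (\prod_(i <- r) e i)`_k = (\sum_(i <- r) x i) ^+ k / k`!%:R.
  elim: r k => [|a r IH] k kn.
    rewrite !big_nil coef1; case: k {kn} => [|k] /=; rewrite ?expr0 ?fact0 ?divr1 //.
    by rewrite expr0n /= mul0r.
  rewrite !big_cons coefM addrC exprDn mulr_suml; apply: eq_bigr => i _.
  have ik : (i <= k)%N by rewrite -ltnS ltn_ord.
  rewrite IH ?(leq_trans (leq_subr _ _) kn) // coef_poly ltnS (leq_trans ik) //.
  rewrite -[_ *+ 'C(k, i)]mulr_natr -(bin_fact ik) !natrM.
  by field; rewrite !fact_neq0 !pnatr_eq0 -lt0n bin_gt0 ik.
rewrite -(coef_e (index_enum I) n) // /e.
under [in RHS]eq_bigr do rewrite poly_def.
rewrite (bigA_distr_bigA (fun i (j : 'I_n.+1) => (x i ^+ j / j`!%:R) *: 'X^j)) /=.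
rewrite coef_sum big_mkcond; apply: eq_bigr => f _.
rewrite [in RHS]scaler_prod -expr_sum coefZ coefXn eq_sym.
by case: ifP => _; rewrite ?mulr1 ?mulr0.
Qed.

(** * Bernstein's inequality for independent Bernoulli variables *)

(** Since [(i+2)! >= 2 * 3^i], the exponential series from its quadratic term on is dominated by a
    geometric series of ratio [l / 3]; this is the origin of the constant 3. *)
Lemma expR_le_Bernstein (R : realType) (l z : R) : 0 <= l < 3 -> `|z| <= l ->
  expR z <= 1 + z + z ^+ 2 / (2 * (1 - l / 3)).
Proof.
move=> /andP[l0 l3] zl.
have q0 : 0 <= l / 3 by lra.
have q1 : l / 3 < 1 by lra.
have fact_ge i : (2 * 3 ^ i <= i.+2`!)%N.
  elim: i => // i IH; rewrite factS expnS mulnCA; exact: leq_mul.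
rewrite /expR; apply: limr_le; first exact: is_cvg_series_exp_coeff.
near=> n.
have n2 : (2 <= n)%N by near: n; exact: nbhs_infty_ge.
rewrite -(subnK n2); set m := (n - 2)%N; rewrite addn2.
rewrite /series /= big_nat_recl // big_nat_recl // /exp_coeff /=.
rewrite expr0 expr1 !fact0 !divr1 addrA lerD2l.
have -> : z ^+ 2 / (2 * (1 - l / 3)) = z ^+ 2 / 2 / (1 - l / 3).
  by field; lra.
apply: (@le_trans _ _ (\sum_(0 <= i < m) z ^+ 2 / 2 * (l / 3) ^+ i)).
  apply: ler_sum => i _.
  apply: (@le_trans _ _ (`|z| ^+ i.+2 / i.+2`!%:R)).
    by rewrite ler_wpM2r ?invr_ge0 // -normrX ler_norm.
  apply: (@le_trans _ _ (`|z| ^+ i.+2 / (2 * 3 ^+ i))).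
    rewrite ler_wpM2l ?exprn_ge0 //.
    have -> : 2 * 3 ^+ i = (2 * 3 ^ i)%:R :> R by rewrite natrM natrX.
    by rewrite lef_pV2 ?posrE ?ltr0n ?fact_gt0 ?muln_gt0 ?expn_gt0 ?ler_nat.
  rewrite -[i.+2]addn2 exprD real_normK ?num_real // expr_div_n.
  rewrite (_ : _ / _ = z ^+ 2 / 2 * (`|z| ^+ i / 3 ^+ i)); last first.
    by field; rewrite expf_neq0 ?pnatr_eq0.
  rewrite ler_wpM2l ?divr_ge0 ?sqr_ge0 // ler_wpM2r ?invr_ge0 ?exprn_ge0 //.
  by rewrite lerXn2r ?nnegrE.
rewrite -mulr_sumr; apply: ler_wpM2l; first by rewrite divr_ge0 ?sqr_ge0.
have := @geometric_seriesE R 1 (l / 3); rewrite lt_eqF // => /(_ isT) /(congr1 (@^~ m)).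
rewrite /series /geometric /=; under eq_bigr do rewrite mul1r; move->.
rewrite mul1r ler_pdivrMr; last lra.
by rewrite mulVf ?gerBl ?exprn_ge0 //; lra.
Unshelve. all: by end_near.
Qed.

(** The variable is centred, so the linear terms of the quadratic bound cancel and the quadratic
    ones add up to the variance [c * (1 - c) * xi ^+ 2]; then [1 + u <= expR u]. *)
Lemma bernoulli_mgf_le (R : realType) (c xi l : R) :
  0 <= c <= 1 -> `|xi| <= 1 -> 0 <= l < 3 ->
  c * expR (l * ((1 - c) * xi)) + (1 - c) * expR (l * ((0 - c) * xi)) <=
  expR (c * (1 - c) * xi ^+ 2 * (l ^+ 2 / (2 * (1 - l / 3)))).
Proof.
move=> /andP[c0 c1] xi1 l03; have /andP[l0 l3] := l03.
have bnd a : `|a| <= 1 -> `|l * (a * xi)| <= l.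
  move=> a1; rewrite normrM ger0_norm // -[leRHS]mulr1 ler_wpM2l // normrM.
  by rewrite mulr_ile1.
have h1 := expR_le_Bernstein l03 (bnd (1 - c) _).
have h0 := expR_le_Bernstein l03 (bnd (0 - c) _).
apply: le_trans (expR_ge1Dx _).
apply: (@le_trans _ _ (c * (1 + l * ((1 - c) * xi) + (l * ((1 - c) * xi)) ^+ 2 / (2 * (1 - l / 3)))
  + (1 - c) * (1 + l * ((0 - c) * xi) + (l * ((0 - c) * xi)) ^+ 2 / (2 * (1 - l / 3))))).
  apply: lerD; apply: ler_wpM2l; rewrite ?subr_ge0 //; [apply: h1|apply: h0].
    by rewrite ger0_norm; lra.
  by rewrite sub0r normrN ger0_norm.
rewrite le_eqVlt; apply/orP; left; apply/eqP; field; lra.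
Qed.

(** With [t] the threshold, the optimal parameter is [l = t / (V + t / 3)]. It turns the left side
    into [- t^2 / (2 (V + t / 3))], which is [- d] by the quadratic equation for [t]. *)
Lemma Bernstein_rate (R : realType) (d V : R) : 0 <= d -> 0 <= V ->
  exists2 l, 0 <= l < 3 &
    V * (l ^+ 2 / (2 * (1 - l / 3)))
    - l * (d / 3 + Num.sqrt ((d / 3) ^+ 2 + 2 * d * V)) <= - d.
Proof.
move=> d0 V0; set s := Num.sqrt _; set t := d / 3 + s.
have arg0 : 0 <= (d / 3) ^+ 2 + 2 * d * V by rewrite addr_ge0 ?sqr_ge0 ?mulr_ge0.
have s0 : 0 <= s by exact: sqrtr_ge0.
have s2 : s ^+ 2 = (d / 3) ^+ 2 + 2 * d * V by rewrite sqr_sqrtr.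
have t2 : t ^+ 2 = 2 * d * (V + t / 3).
  rewrite /t; transitivity (d^+2/9 + 2 * d / 3 * s + s ^+ 2); first by field.
  by rewrite s2; field.
have [->|dn0] := eqVneq d 0.
  by exists 0; [lra|rewrite expr0n /= !mul0r mulr0 subrr oppr0].
have dpos : 0 < d by rewrite lt_neqAle eq_sym dn0.
have tpos : 0 < t by rewrite /t; lra.
have [V_0|Vn0] := eqVneq V 0.
  (* For [V = 0] the general choice would give 3, which is excluded. Here [t = 2 d / 3], so [3 / 2]
     yields exactly [- d]. *)
  exists (3 / 2); first lra.
  rewrite V_0 mul0r add0r.
  have : t * (t - 2 * d / 3) = 0.
    by rewrite mulrBr -expr2 t2 V_0; field.
  move/eqP; rewrite mulf_eq0 gt_eqF //= subr_eq0 => /eqP ->.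
  by lra.
have Vpos : 0 < V by rewrite lt_neqAle eq_sym Vn0.
exists (t / (V + t / 3)).
  apply/andP; split; first by rewrite divr_ge0; lra.
  by rewrite ltr_pdivrMr; lra.
have wpos : 0 < V + t / 3 by lra.
rewrite (_ : _ - _ = - (t ^+ 2 / (2 * (V + t / 3)))); last first.
  by field; rewrite !gt_eqF //=; lra.
by rewrite t2 lerN2 ler_pdivlMr; lra.
Qed.

Lemma Bernstein_tail (R : realType) (A : eqType) (s : seq A) (c xi : A -> R) (d : R) :
  s != [::] -> 0 <= d -> {in s, forall a, 0 <= c a <= 1 /\ `|xi a| <= 1} ->
  \sum_(x : (size s).-tuple bool |
      ~~ ((\sum_(t <- zip s x) ((t.2 : nat)%:R - c t.1) * xi t.1) / (size s)%:R
          <= d / 3 + Num.sqrt ((d / 3) ^+ 2 + 2 * d *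
               ((\sum_(a <- s) c a * (1 - c a) * xi a ^+ 2) / (size s)%:R))))
    \prod_(t <- zip s x) (c t.1 ^+ t.2 * (1 - c t.1) ^+ (1 - t.2)) <=
  expR (- ((size s)%:R * d)).
Proof.
move=> s0 d0 hs; set n := (size s)%:R; set V := _ / n.
have npos : 0 < n by rewrite ltr0n lt0n size_eq0.
have V0 : 0 <= V.
  rewrite divr_ge0 ?(ltW npos) // big_seq sumr_ge0 // => a /hs[/andP[c0 c1] _].
  by rewrite mulr_ge0 ?sqr_ge0 ?mulr_ge0 ?subr_ge0.
have [l l03 hl] := Bernstein_rate d0 V0; have /andP[l0 l3] := l03.
move: hl; set t := _ + Num.sqrt _; set k := _ / _ => hl.
pose S (x : (size s).-tuple bool) := \sum_(t <- zip s x) ((t.2 : nat)%:R - c t.1) * xi t.1.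
pose w (p : A * bool) := c p.1 ^+ p.2 * (1 - c p.1) ^+ (1 - p.2).
have w_ge0 (x : (size s).-tuple bool) : 0 <= \prod_(t <- zip s x) w t.
  rewrite big_seq prodr_ge0 // => p /(map_f fst).
  rewrite -/unzip1 unzip1_zip ?size_tuple // => /hs[/andP[c0 c1] _].
  by rewrite mulr_ge0 ?exprn_ge0 ?subr_ge0.
(* Exponential Markov inequality: on the bad event [expR (l * (S x - n * t))] is at least 1. *)
apply: (@le_trans _ _ (\sum_(x : (size s).-tuple bool)
    expR (- (l * (n * t))) * \prod_(p <- zip s x) (w p * expR (l * (((p.2 : nat)%:R - c p.1) * xi p.1))))).
  rewrite big_mkcond; apply: ler_sum => x _.
  rewrite [in leRHS]big_split /= -expR_sum -mulr_sumr -/(S x) mulrCA -expRD.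
  case: ifPn => [|_]; last by rewrite mulr_ge0 ?expR_ge0.
  rewrite -ltNge ltr_pdivlMr // => bad.
  rewrite ler_peMr // -[leLHS]expR0 ler_expR addrC -mulrBr mulr_ge0 // subr_ge0.
  by rewrite ltW // mulrC.
rewrite -mulr_sumr (sum_tuple_prod_zip (fun p => w p * expR (l * (((p.2 : nat)%:R - c p.1) * xi p.1)))).
apply: (@le_trans _ _ (expR (- (l * (n * t))) * expR (n * V * k))).
  rewrite ler_wpM2l ?expR_ge0 // mulrC [V]mulrC mulVKf ?gt_eqF //.
  rewrite mulr_sumr expR_sum big_seq [leRHS]big_seq.
  apply: ler_prod => a as_; have [c01 xi1] := hs _ as_.
  rewrite big_bool /w /= !expr1 !expr0 mulr1 mul1r.
  have /andP[c0 c1] := c01.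
  rewrite addr_ge0 ?mulr_ge0 ?expR_ge0 ?subr_ge0 //= [k * _]mulrC.
  exact: bernoulli_mgf_le.
rewrite -expRD ler_expR -[leRHS]mulrN.
have -> : - (l * (n * t)) + n * V * k = n * (V * k - l * t) by ring.
by rewrite ler_pM2l.
Qed.

(** * Large deviations of the multinomial counts *)

Lemma binom_ge0 (R : realType) (L : nat) (p : R) (M : nat) :
  0 <= p <= 1 -> 0 <= binom L p M.
Proof.
by move=> /andP[p0 p1]; rewrite !mulr_ge0 ?exprn_ge0 ?subr_ge0.
Qed.

Lemma sum_binom (R : realType) (L : nat) (p : R) :
  \sum_(M < L.+1) binom L p M = 1.
Proof.
rewrite -[RHS](expr1n _ L) -[in RHS](subrK p 1) exprDn.
by apply: eq_bigr => M _; rewrite /binom -[RHS]mulr_natl mulrAC -mulrA.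
Qed.

(** As a function of [p], the likelihood [p^M (1-p)^(L-M)] increases up to [p = M / L]. Instead of
    differentiating, both factors of the likelihood ratio are bounded by [x <= expR (x - 1)]; the
    exponents add up to [(q - p) (M - L p) / (p (1 - p)) <= 0]. *)
Lemma binom_le (R : realType) (L : nat) (p q : R) (M : 'I_L.+1) :
  0 <= q <= p -> p <= 1 -> L%:R * p <= M%:R -> binom L q M <= binom L p M.
Proof.
move=> /andP[q0 qp] p1 hM; have ML : (M <= L)%N by rewrite -ltnS.
rewrite /binom -!mulrA ler_wpM2l //.
have [p_0|pn0] := eqVneq p 0; first by have -> : q = p by lra.
have [p_1|pn1] := eqVneq p 1.
  have -> : M = L :> nat.
    by apply/eqP; rewrite eqn_leq ML /= -(ler_nat R); move: hM; rewrite p_1 mulr1.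
  by rewrite subnn !expr0 !mulr1 lerXn2r ?nnegrE //; lra.
have p_pos : 0 < p by rewrite lt_neqAle eq_sym pn0 /=; lra.
have p_lt1 : 0 < 1 - p by rewrite subr_gt0 lt_neqAle pn1.
rewrite -[leRHS]mul1r -ler_pdivrMr; last by rewrite mulr_gt0 ?exprn_gt0.
have -> : q ^+ M * (1 - q) ^+ (L - M) / (p ^+ M * (1 - p) ^+ (L - M)) =
          (q / p) ^+ M * ((1 - q) / (1 - p)) ^+ (L - M).
  by rewrite !expr_div_n invfM; ring.
have expR_ge (x : R) : x <= expR (x - 1).
  by have := expR_ge1Dx (x - 1); rewrite addrC subrK.
apply: (@le_trans _ _ (expR (q / p - 1) ^+ M * expR ((1 - q) / (1 - p) - 1) ^+ (L - M))).
  by apply: ler_pM; rewrite ?exprn_ge0 ?divr_ge0 ?lerXn2r ?nnegrE ?expR_ge0 ?divr_ge0 //; lra.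
rewrite -!expRM_natl -expRD -[leRHS]expR0 ler_expR natrB //.
have -> : M%:R * (q / p - 1) + (L%:R - M%:R) * ((1 - q) / (1 - p) - 1) =
   (q - p) * ((M%:R - L%:R * p) / (p * (1 - p))) :> R.
  by field; rewrite !gt_eqF.
by rewrite mulr_le0_ge0 ?divr_ge0 ?mulr_ge0 ?(ltW p_pos) ?(ltW p_lt1) ?subr_ge0 //; lra.
Qed.

(** The sum is the derivative of the moment generating function. It is non-positive at 0 and
    non-negative once the atom [i0] dominates, so the intermediate value theorem gives a zero. *)
Lemma exists_tilt (R : realType) (I : finType) (b g : I -> R) (i0 : I) :
  (forall i, 0 <= b i) -> \sum_i b i * g i <= 0 -> 0 < b i0 -> 0 < g i0 ->
  exists2 l, 0 <= l & \sum_i b i * expR (l * g i) * g i = 0.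
Proof.
move=> b0 bg bi0 gi0.
pose f l := \sum_i b i * expR (l * g i) * g i.
pose C := \sum_i b i * `|g i|.
(* Chosen so that [b i0 * (l1 * g i0) * g i0 = C], while the other atoms contribute at least
   [- C]. *)
pose l1 := C / (b i0 * g i0 ^+ 2).
have den : 0 < b i0 * g i0 ^+ 2 by rewrite mulr_gt0 ?exprn_gt0.
have C0 : 0 <= C by rewrite sumr_ge0 // => i _; rewrite mulr_ge0.
have l10 : 0 <= l1 by rewrite divr_ge0 // ltW.
have f0 : f 0 <= 0.
  by rewrite /f; under eq_bigr do rewrite mul0r expR0 mulr1.
have f1 : 0 <= f l1.
  rewrite /f (bigD1 i0) //=.
  have h1 : C <= b i0 * expR (l1 * g i0) * g i0.
    have -> : C = b i0 * (l1 * g i0) * g i0 by rewrite /l1; field; rewrite !gt_eqF.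
    rewrite ler_wpM2r ?(ltW gi0) // ler_wpM2l ?(ltW bi0) //.
    by have := expR_ge1Dx (l1 * g i0); lra.
  have h2 : - C <= \sum_(i | i != i0) b i * expR (l1 * g i) * g i.
    apply: (@le_trans _ _ (\sum_(i | i != i0) - (b i * `|g i|))).
      rewrite sumrN lerN2 /C [leRHS](bigD1 i0) //= lerDr mulr_ge0 //.
    apply: ler_sum => i _; rewrite -mulrA -mulrN ler_wpM2l //.
    have [g0|g0] := leP 0 (g i).
      by apply: (@le_trans _ _ 0); rewrite ?oppr_le0 // mulr_ge0 ?expR_ge0.
    rewrite ltr0_norm // opprK -[leLHS]mul1r ler_wnM2r ?(ltW g0) //.
    by rewrite -[leRHS]expR0 ler_expR mulr_ge0_le0 // ltW.
  lra.
have cf : continuous f.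
  move=> x; rewrite /f; elim: (index_enum I) => [|i r IH].
    by under eq_fun do rewrite big_nil; exact: cvg_cst.
  under eq_fun do rewrite big_cons; apply: cvgD IH.
  apply: cvgM; last exact: cvg_cst.
  apply: cvgM; first exact: cvg_cst.
  apply: continuous_cvg; first exact: continuous_expR.
  by apply: cvgM; [exact: cvg_id|exact: cvg_cst].
have [//||l] := @IVT R f 0 l1 0 l10.
- exact: continuous_subspaceT.
- by rewrite ge_min le_max f0 f1 orbT.
by rewrite in_itv /= => /andP[l0 _] fl; exists l.
Qed.

(** On the event, [expR (l * \sum_i f i * g i)] is at least 1. It is absorbed into the weights
    [b i], and the multinomial theorem sums the result. *)
Lemma multinomial_Chernoff (R : realType) (I : finType) (b g : I -> R) (n : nat) (l : R) :
  (forall i, 0 <= b i) -> 0 <= l ->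
  \sum_(f : {ffun I -> 'I_n.+1} | ((\sum_i f i)%N == n) && (0 < \sum_i (f i)%:R * g i))
    (n`!%:R / (\prod_i (f i)`!)%:R * \prod_i b i ^+ f i) <=
  (\sum_i b i * expR (l * g i)) ^+ n.
Proof.
move=> b0 l0.
have fn0 : n`!%:R != 0 :> R by rewrite pnatr_eq0 -lt0n fact_gt0.
rewrite -[leRHS](mulfK fn0) [leRHS]mulrAC -sum_multinomial [leRHS]mulrC mulr_sumr.
rewrite big_mkcondr /=; apply: ler_sum => f _.
pose w := n`!%:R / (\prod_i (f i)`!)%:R * \prod_i b i ^+ f i.
have w0 : 0 <= w by rewrite mulr_ge0 ?divr_ge0 ?prodr_ge0 // => i _; rewrite exprn_ge0.
have -> : n`!%:R * (\prod_i ((b i * expR (l * g i)) ^+ f i / (f i)`!%:R)) =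
          w * expR (l * \sum_i (f i)%:R * g i).
  rewrite big_split /= prodfV -natr_prod mulr_sumr expR_sum /w.
  under eq_bigr do rewrite exprMn -expRM_natl mulrCA.
  by rewrite big_split /=; ring.
case: ifP => [pos|_]; last by rewrite mulr_ge0 ?expR_ge0.
by rewrite ler_peMr // -[leLHS]expR0 ler_expR mulr_ge0 // ltW.
Qed.

(** The log-density of the tilted law [Q] relative to [b] is [l * g - ln Z]. As [g] has [Q]-mean 0,
    the divergence is [- log2 Z]. *)
Lemma pow2neg_KL_tilt (R : realType) (L : nat) (b g : 'I_L.+1 -> R) (l Z : R) (n : nat)
    (Q : {ffun 'I_L.+1 -> R}) :
  0 < Z -> (forall i, 0 <= b i) -> (forall i, Q i = b i * expR (l * g i) / Z) ->
  \sum_i Q i = 1 -> \sum_i Q i * g i = 0 ->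
  pow2neg (n%:R%:E * KL Q b)%E = Z ^+ n.
Proof.
move=> Z0 b0 QE Q1 Qg.
have ln2 : 0 < ln 2 :> R by rewrite ln_gt0 ?ltr1n.
have Q_b i : Q i != 0 -> b i != 0.
  by apply: contraNneq => bi; rewrite QE bi !mul0r.
rewrite /KL ifF; last first.
  by apply/negbTE/existsPn => i; rewrite negb_and negbK; case: eqVneq => //= /Q_b.
have -> : \sum_i (if Q i == 0 then 0 else Q i * log2 (Q i / b i)) = - (ln Z / ln 2).
  transitivity (\sum_i (Q i * g i * (l / ln 2) + Q i * (- (ln Z / ln 2)))); last first.
    by rewrite big_split /= -!mulr_suml Qg Q1 mul0r add0r mul1r.
  apply: eq_bigr => i _; case: eqVneq => [->|Qi]; first by rewrite !mul0r addr0.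
  have -> : Q i / b i = expR (l * g i) / Z.
    by rewrite QE; field; rewrite gt_eqF //= Q_b.
  rewrite /log2 ln_div ?posrE ?expR_gt0 // expRK.
  by field; rewrite gt_eqF.
rewrite -EFinM /= mulrN opprK mulrA /powR pnatr_eq0 /=.
rewrite divfK ?gt_eqF // expRM_natl lnK ?posrE //.
Qed.

(* Chernoff's bound at the tilt whose mean is the threshold is exactly the
   Sanov exponent of the tilted law.  Passing from [q] to [p] only increases
   the moment generating function, because [binom L q <= binom L p] wherever
   [nu] does not vanish. *)
Lemma multinomial_tail_KL (R : realType) (L n : nat) (p q : R) (nu : 'I_L.+1 -> R)
    (delta eta : R) :
  0 <= q <= p -> p <= 1 -> (forall M, 0 <= nu M) ->
  (forall M : 'I_L.+1, M%:R < L%:R * p -> nu M = 0) -> 0 <= delta -> 0 <= eta ->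
  (forall Q : {ffun 'I_L.+1 -> R}, isPM Q ->
     Ebin p nu + delta <= \sum_M Q M * nu M ->
     pow2neg (n%:R%:E * KL Q (binom L p))%E <= eta) ->
  \sum_(f : {ffun 'I_L.+1 -> 'I_n.+1} | ((\sum_M f M)%N == n) &&
        (n%:R * (Ebin p nu + delta) < \sum_M (f M)%:R * nu M))
    (n`!%:R / (\prod_M (f M)`!)%:R * \prod_(M < L.+1) binom L q M ^+ f M) <= eta.
Proof.
move=> q0p p1 nu0 nuS d0 eta0 hmax; have /andP[q0 qp] := q0p.
have p01 : 0 <= p <= 1 by rewrite p1 (le_trans q0).
have q01 : 0 <= q <= 1 by rewrite q0 (le_trans qp).
set a := Ebin p nu + delta.
pose b (M : 'I_L.+1) := binom L p M; pose b' (M : 'I_L.+1) := binom L q M.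
have b0 M : 0 <= b M by exact: binom_ge0.
have b'0 M : 0 <= b' M by exact: binom_ge0.
have bb' M : nu M != 0 -> b' M <= b M.
  move=> nM; apply: binom_le => //; rewrite leNgt.
  by apply: contra nM => /nuS ->.
pose g M := nu M - a.
have E0 : 0 <= Ebin p nu by rewrite sumr_ge0 // => M _; rewrite mulr_ge0 ?binom_ge0.
have sumg (f : {ffun 'I_L.+1 -> 'I_n.+1}) : (\sum_M f M)%N = n ->
    \sum_M (f M)%:R * g M = \sum_M (f M)%:R * nu M - n%:R * a.
  move=> fn; rewrite -[X in X%:R * a]fn natr_sum mulr_suml -sumrB.
  by apply: eq_bigr => M _; rewrite mulrBr.
(* If [b] has an atom above the threshold, a tilt with mean [a] exists. Otherwise every count vector
   in the event uses some [M] with [b' M = 0], and the sum is 0. *)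
have [/existsP[M0 /andP[bM0 gM0]]|noM0] :=
    boolP [exists M, (0 < b M) && (0 < g M)].
  have bg : \sum_M b M * g M <= 0.
    rewrite /g; under eq_bigr do rewrite mulrBr.
    by rewrite sumrB -mulr_suml sum_binom mul1r -/(Ebin p nu) /a; lra.
  have [l l0 hl] := exists_tilt b0 bg bM0 gM0.
  pose Z := \sum_M b M * expR (l * g M).
  have Z0 : 0 < Z.
    rewrite /Z (bigD1 M0) //=; apply: ltr_pwDl; first by rewrite mulr_gt0 ?expR_gt0.
    by apply: sumr_ge0 => M _; rewrite mulr_ge0 ?expR_ge0.
  pose Q := [ffun M => b M * expR (l * g M) / Z].
  have QE M : Q M = b M * expR (l * g M) / Z by rewrite ffunE.
  have Q1 : \sum_M Q M = 1.
    by under eq_bigr do rewrite QE; rewrite -mulr_suml divff ?gt_eqF.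
  have Qg : \sum_M Q M * g M = 0.
    under eq_bigr do rewrite QE mulrAC.
    by rewrite -mulr_suml hl mul0r.
  have Q0 M : 0 <= Q M.
    rewrite QE; apply: divr_ge0; last exact: ltW.
    by apply: mulr_ge0; [exact: b0|exact: expR_ge0].
  have Qnu : a <= \sum_M Q M * nu M.
    move: Qg; rewrite /g; under eq_bigr do rewrite mulrBr.
    by rewrite sumrB -mulr_suml Q1 mul1r => /eqP; rewrite subr_eq0 => /eqP ->.
  have := hmax Q (conj Q0 Q1) Qnu; rewrite (pow2neg_KL_tilt n Z0 b0 QE Q1 Qg).
  apply: le_trans.
  apply: (@le_trans _ _ ((\sum_M b' M * expR (l * g M)) ^+ n)).
    rewrite (eq_bigl (fun f : {ffun 'I_L.+1 -> 'I_n.+1} => ((\sum_M f M)%N == n) && (0 < \sum_M (f M)%:R * g M))).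
      exact: multinomial_Chernoff.
    by move=> f; case: eqVneq => //= fn; rewrite (sumg _ fn) subr_gt0.
  rewrite lerXn2r ?nnegrE ?(ltW Z0) ?sumr_ge0 //.
    by move=> M _; rewrite mulr_ge0 ?expR_ge0.
  (* The constant part contributes equally to both sums, since both laws have mass 1. The other part
     is non-negative and vanishes where [nu M = 0], so [b' <= b] is used only where it is known. *)
  have gE M : expR (l * g M) = expR (- (l * a)) * (expR (l * nu M) - 1) + expR (- (l * a)).
    by rewrite [in RHS]mulrBr mulr1 subrK -expRD /g; congr expR; ring.
  rewrite /Z; under eq_bigr do rewrite gE mulrDr.
  under [leRHS]eq_bigr do rewrite gE mulrDr.
  rewrite !big_split /= -!mulr_suml !sum_binom lerD2r; apply: ler_sum => M _.
  have [->|nM] := eqVneq (nu M) 0; first by rewrite mulr0 expR0 subrr !mulr0.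
  rewrite ler_wpM2r ?bb' // mulr_ge0 ?expR_ge0 // subr_ge0 -[leLHS]expR0 ler_expR.
  exact: mulr_ge0.
rewrite big1 // => f /andP[/eqP fn]; rewrite -subr_gt0 -(sumg _ fn) => pos.
have [M fM gM] : exists2 M, f M != 0%N :> nat & 0 < g M.
  apply: contrapT => noM; move: pos; apply/negP; rewrite -leNgt sumr_le0 // => M _.
  have [->|fM] := eqVneq (f M : nat) 0%N; first by rewrite mul0r.
  rewrite mulr_ge0_le0 // leNgt; apply/negP => gM; apply: noM; by exists M.
have nM : nu M != 0 by move: gM; rewrite /g /a subr_gt0 => gM; rewrite gt_eqF //; lra.
have b'M : b' M = 0.
  apply/eqP; rewrite eq_le b'0 andbT (le_trans (bb' _ nM)) // leNgt.
  by move/existsPn: noM0 => /(_ M); rewrite gM andbT.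
by rewrite [X in _ * X](bigD1 M) //= -/(b' M) b'M expr0n (negbTE fM) mul0r mulr0.
Qed.

(** * Types, marginals and conditional entropy *)

Lemma sum_tp (R : realType) (T : finType) (s : seq T) (F : T -> R) :
  \sum_t tp R s t * F t = (\sum_(t <- s) F t) / (size s)%:R.
Proof.
rewrite /tp; under eq_bigr do rewrite mulrAC.
rewrite -mulr_suml; congr (_ / _).
elim: s => [|a s IH]; first by rewrite big_nil big1 // => t _; rewrite mul0r.
rewrite big_cons -IH /=; under eq_bigr do rewrite natrD mulrDl.
rewrite big_split /= (bigD1 a) //= eqxx mul1r big1 ?addr0 // => t ta.
by rewrite eq_sym (negbTE ta) mul0r.
Qed.

Lemma tp_ge0 (R : realType) (T : eqType) (s : seq T) (t : T) : 0 <= tp R s t.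
Proof. by rewrite divr_ge0. Qed.

Lemma tp_gt0 (R : realType) (T : eqType) (s : seq T) (t : T) : t \in s -> 0 < tp R s t.
Proof.
move=> ts; rewrite divr_gt0 ?ltr0n -?has_count ?has_pred1 //.
by case: s ts.
Qed.

Lemma sum_margM (R : realType) (L : nat) (P : {ffun Tri L -> R}) (F : 'I_L.+1 -> R) :
  \sum_M margM P M * F M = \sum_t P t * F t.1.1.
Proof.
rewrite [RHS](partition_big (fun t : Tri L => t.1.1) xpredT) //=.
by apply: eq_bigr => M _; rewrite mulr_suml; apply: eq_bigr => t /eqP ->.
Qed.

Lemma sum_margMU (R : realType) (L : nat) (P : {ffun Tri L -> R})
    (F : 'I_L.+1 -> bool -> R) :
  \sum_M \sum_U margMU P M U * F M U = \sum_t P t * F t.1.1 t.1.2.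
Proof.
rewrite pair_big /= [RHS](partition_big (fun t : Tri L => t.1) xpredT) //=.
apply: eq_bigr => -[M U] _ /=; rewrite mulr_suml; apply: eq_big => [t|t].
  by rewrite -[t.1 == _]/((t.1.1 == M) && (t.1.2 == U)).
by move=> /andP[/eqP -> /eqP ->].
Qed.

(** Expresses the entropy as a [P]-expectation over triples, which for a mean of types becomes an
    average along sequences. A triple outside [inW] may have an [fY] value beyond the index range of
    [condH], but it carries no mass. *)
Lemma condH_support (R : realType) (L : nat) (P : {ffun Tri L -> R}) :
  (2 <= L)%N -> isPW P ->
  condH P = - \sum_t P t * log2 (PXY P t.2 (fY t) / PY P (fY t)).
Proof.
move=> L2 [_ _ PW]; rewrite /condH; congr (- _).
pose G t := P t * log2 (PXY P t.2 (fY t) / PY P (fY t)).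
transitivity (\sum_(a < L - 1) \sum_(b : bool) \sum_(x : bool)
   \sum_t (if (t.2 == x) && (fY t == (nat_of_ord a, b)) then G t else 0)).
  apply: eq_bigr => a _; apply: eq_bigr => b _; apply: eq_bigr => x _ /=.
  transitivity (PXY P x (nat_of_ord a, b) *
      log2 (PXY P x (nat_of_ord a, b) / PY P (nat_of_ord a, b))).
    by case: eqVneq => [->|//]; rewrite mul0r.
  rewrite -big_mkcond {1}/PXY mulr_suml; apply: eq_bigr => t /andP[/eqP tx /eqP ty].
  by rewrite /G tx ty.
rewrite pair_big pair_big exchange_big /=; apply: eq_bigr => t _.
have [tW|/PW Pt0] := boolP (inW t); last first.
  by rewrite /G Pt0 mul0r big1 // => p _; rewrite if_same.
have aL : (t.1.1 - t.1.2 - t.2 < L - 1)%N.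
  by move: tW => /andP[_] /leq_ltn_trans; apply; rewrite ltn_sub2l.
rewrite -big_mkcond /= (big_pred1 ((Ordinal aL, addb t.1.2 t.2), t.2)) //.
case=> -[a b] x /=; apply/andP/eqP => [[/eqP <- /eqP[ea <-]]|[-> -> ->]] //=.
by congr ((_, _), _); apply/val_inj.
Qed.

(** Jensen's inequality for [expR], from its tangent at the mean [m]: the linear terms sum to 0. *)
Lemma card_mul_expR_mean_le1 (R : realType) (X : finType) (T : {set X}) (a : X -> R) :
  \sum_(x in T) expR (a x) <= 1 ->
  #|T|%:R * expR ((\sum_(x in T) a x) / #|T|%:R) <= 1.
Proof.
have [T0|Tn0] := eqVneq #|T| 0%N; first by rewrite T0 mul0r.
apply: le_trans; set m := _ / _.
apply: (@le_trans _ _ (\sum_(x in T) expR m * (1 + (a x - m)))).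
  rewrite -mulr_sumr big_split /= sumrB !sumr_const -[m *+ _]mulr_natr {2}/m.
  by rewrite divfK ?pnatr_eq0 // subrr addr0 mulrC.
apply: ler_sum => x _; rewrite -[leRHS](congr1 expR (subrKC m (a x))) expRD.
by rewrite ler_wpM2l ?expR_ge0 ?expR_ge1Dx.
Qed.

(** * The mean type over a set of sequences, and its membership in the constraint sets *)

Section Average.
Variables (R : realType) (L : nat).
Variables (X : finType) (T : {set X}) (s : X -> seq (Tri L)) (n : nat).
Hypotheses (T_gt0 : (0 < #|T|)%N) (n_gt0 : (0 < n)%N).
Hypothesis size_s : forall x, x \in T -> size (s x) = n.
Hypothesis s_inW : forall x, x \in T -> all (@inW L) (s x).

Definition mean_tp : {ffun Tri L -> R} :=
  [ffun t => (\sum_(x in T) tp R (s x) t) / #|T|%:R].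

Let Tn0 : #|T|%:R != 0 :> R. Proof. by rewrite pnatr_eq0 -lt0n. Qed.

Lemma sum_mean_tp F :
  \sum_t mean_tp t * F t = (\sum_(x in T) \sum_t tp R (s x) t * F t) / #|T|%:R.
Proof.
rewrite exchange_big mulr_suml; apply: eq_bigr => t _.
by rewrite ffunE mulrAC mulr_suml.
Qed.

Lemma mean_tp_gt0 x t : x \in T -> t \in s x -> 0 < mean_tp t.
Proof.
move=> xT tx; rewrite ffunE divr_gt0 ?ltr0n // (bigD1 x) //=.
by rewrite ltr_pwDl ?tp_gt0 // sumr_ge0 // => z _; rewrite tp_ge0.
Qed.

Lemma mean_tp_isPW : isPW mean_tp.
Proof.
split=> [t||t tW].
- by rewrite ffunE divr_ge0 // sumr_ge0 // => x _; rewrite tp_ge0.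
- under eq_bigr do rewrite -[mean_tp _]mulr1.
  rewrite sum_mean_tp (eq_bigr (fun=> 1)) => [|x xT]; first by rewrite sumr_const divff.
  by rewrite sum_tp big_const_seq count_predT iter_addr_0 size_s // divff // pnatr_eq0 -lt0n.
- rewrite ffunE big1 ?mul0r // => x xT; rewrite /tp (count_memPn _) ?mul0r //.
  by apply: contra tW => /(allP (s_inW xT)).
Qed.

End Average.

Lemma cc_inW (R : realType) (L : nat) (t : Tri L) :
  (2 <= L)%N -> inW t -> 0 <= cc R L t.1.1 t.1.2 <= 1.
Proof.
move=> L2 /andP[h1 h2]; set M := nat_of_ord t.1.1; set U : nat := t.1.2.
have UM : (U <= M)%N by rewrite /U /M; lia.
have ML : (M - U <= L - 1)%N by rewrite /U /M; case: (t.2) h1 h2 => /=; lia.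
have L1 : 0 < L%:R - 1 :> R by rewrite subr_gt0 ltr1n.
rewrite /cc -natrB // divr_ge0 ?(ltW L1) //= ler_pdivrMr // mul1r.
by rewrite -[X in _ - X]/(1%:R) -natrB ?ler_nat // ltnW.
Qed.

(** Concavity of the square root, from the non-negative variance of [Num.sqrt (B x)] over [T]. *)
Lemma mean_sqrt_le (R : realType) (X : finType) (T : {set X}) (B : X -> R) :
  (0 < #|T|)%N -> (forall x, x \in T -> 0 <= B x) ->
  (\sum_(x in T) Num.sqrt (B x)) / #|T|%:R <= Num.sqrt ((\sum_(x in T) B x) / #|T|%:R).
Proof.
move=> T0 B0; set K := #|T|%:R; set m := _ / K.
have K0 : 0 < K by rewrite ltr0n.
have m0 : 0 <= m by rewrite divr_ge0 ?(ltW K0) ?sumr_ge0 // => x _; rewrite sqrtr_ge0.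
rewrite -[leLHS]ger0_norm // -sqrtr_sqr ler_wsqrtr // ler_pdivlMr //.
have : 0 <= \sum_(x in T) (Num.sqrt (B x) - m) ^+ 2.
  by rewrite sumr_ge0 // => x _; rewrite sqr_ge0.
rewrite (eq_bigr (fun x => B x - (Num.sqrt (B x) * (2 * m) - m ^+ 2))); last first.
  by move=> x xT; rewrite sqrrB (sqr_sqrtr (B0 x xT)); ring.
have mK : \sum_(x in T) Num.sqrt (B x) = m * K by rewrite divfK // gt_eqF.
rewrite !sumrB -mulr_suml sumr_const -[m ^+ 2 *+ _]mulr_natr -/K mK => h.
by rewrite -subr_ge0 (le_trans h) // le_eqVlt; apply/orP; left; apply/eqP; ring.
Qed.

Section MeanType.
Variables (R : realType) (L : nat).
Hypothesis L2 : (2 <= L)%N.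
Variables (X : finType) (T : {set X}) (s : X -> seq (Tri L)).
Hypothesis T_gt0 : (0 < #|T|)%N.
Hypothesis s_inW : forall x, x \in T -> all (@inW L) (s x).

Let Tn0 : #|T|%:R != 0 :> R. Proof. by rewrite pnatr_eq0 -lt0n. Qed.

Lemma mean_le (A : X -> R) (C : R) :
  (forall x, x \in T -> A x <= C) -> (\sum_(x in T) A x) / #|T|%:R <= C.
Proof.
move=> AC; rewrite ler_pdivrMr ?ltr0n // mulr_natr -sumr_const; exact: ler_sum.
Qed.

Lemma mean_tp_inP1 (Nem n : nat) (p d : R) (nu : 'I_L.+1 -> R) :
  (forall x, x \in T -> inP1 Nem n p nu d [ffun t => tp R (s x) t]) ->
  inP1 Nem n p nu d (mean_tp R T s).
Proof.
rewrite /inP1 sum_margM sum_mean_tp => h; apply: mean_le => x /h.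
by rewrite sum_margM; under eq_bigr do rewrite ffunE.
Qed.

Lemma mean_tp_inP2 (xi : 'I_L.+1 -> bool -> R) (d : R) : 0 <= d ->
  (forall x, x \in T -> inP2 xi d [ffun t => tp R (s x) t]) ->
  inP2 xi d (mean_tp R T s).
Proof.
move=> d0 h; pose G (t : Tri L) := cc R L t.1.1 t.1.2 * (1 - cc R L t.1.1 t.1.2) * xi t.1.1 t.1.2 ^+ 2.
pose V x := \sum_t tp R (s x) t * G t.
pose B x := (d / 3) ^+ 2 + 2 * d * V x.
have V0 x : x \in T -> 0 <= V x.
  move=> xT; rewrite /V sum_tp divr_ge0 // big_seq sumr_ge0 // => t tx.
  have /andP[c0 c1] := cc_inW R L2 (allP (s_inW xT) _ tx).
  by rewrite /G mulr_ge0 ?sqr_ge0 // mulr_ge0 ?subr_ge0.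
have B0 x : x \in T -> 0 <= B x.
  by move=> /V0 Vx; rewrite addr_ge0 ?sqr_ge0 ?mulr_ge0.
rewrite /inP2 sum_mean_tp.
rewrite (sum_margMU _ (fun M U => cc R L M U * (1 - cc R L M U) * xi M U ^+ 2)) /=.
rewrite -/G (sum_mean_tp T s G) -/V.
have -> : (d / 3) ^+ 2 + 2 * d * ((\sum_(x in T) V x) / #|T|%:R) = (\sum_(x in T) B x) / #|T|%:R.
  by rewrite big_split /= sumr_const -mulr_sumr -[_ ^+ 2 *+ _]mulr_natr; field.
apply: (@le_trans _ _ (d / 3 + (\sum_(x in T) Num.sqrt (B x)) / #|T|%:R)); last first.
  by rewrite lerD2l mean_sqrt_le.
have -> : d / 3 = (\sum_(x in T) d / 3) / #|T|%:R.
  by rewrite sumr_const -[d / 3 *+ _]mulr_natr mulfK.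
rewrite -mulrDl -big_split /= ler_wpM2r ?invr_ge0 //; apply: ler_sum => x xT.
have := h x xT; rewrite /inP2.
rewrite (sum_margMU _ (fun M U => cc R L M U * (1 - cc R L M U) * xi M U ^+ 2)) /=.
under eq_bigr do rewrite ffunE; under [in X in _ <= X -> _]eq_bigr do rewrite ffunE.
by [].
Qed.

End MeanType.

(* The mean type [P] yields a product of conditional laws [P(x|y_k)], of total
   mass at most 1; by Jensen its log-mass on [T] is at least
   [log2 #|T| - n * condH P]. *)
Lemma log2_card_le_condH (R : realType) (L : nat) (y : seq (nat * bool))
    (T : {set (size y).-tuple bool}) (s : (size y).-tuple bool -> seq (Tri L)) :
  (2 <= L)%N -> (0 < size y)%N -> (0 < #|T|)%N ->
  (forall x, x \in T ->
     [/\ map snd (s x) = x, map (@fY L) (s x) = y & all (@inW L) (s x)]) ->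
  log2 #|T|%:R <= (size y)%:R * condH (mean_tp R T s).
Proof.
move=> L2 y0 T0 hs; set n := size y; set P := mean_tp R T s.
have size_s x : x \in T -> size (s x) = n.
  by move=> /hs[_ sy _]; rewrite /n -sy size_map.
have PW : isPW P by apply: (mean_tp_isPW _ T0 y0 size_s) => x /hs[].
rewrite (condH_support L2 PW); have [P0 _ _] := PW.
(* The conditional law [P(x|y)]. *)
pose q (p : (nat * bool) * bool) := PXY P p.2 p.1 / PY P p.1.
have PXY0 b z : 0 <= PXY P b z by rewrite sumr_ge0.
have PY0 z : 0 <= PY P z by rewrite sumr_ge0.
have q0 p : 0 <= q p by rewrite divr_ge0.
(* Each triple occurring in some [s x] has positive mean mass, so [expR] inverts [ln] on the factors
   that occur. *)
have q_gt0 x t : x \in T -> t \in s x -> 0 < q (fY t, t.2).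
  move=> xT tx; have Pt : 0 < P t by exact: mean_tp_gt0 tx.
  have XY : 0 < PXY P t.2 (fY t).
    rewrite /PXY (bigD1 t) ?eqxx //= ltr_pwDl // sumr_ge0 //.
  by rewrite divr_gt0 // /PY (bigD1 t.2) //= ltr_pwDl // sumr_ge0.
pose a x := \sum_(t <- s x) ln (q (fY t, t.2)).
have ea x : x \in T -> expR (a x) = \prod_(p <- zip y x) q p.
  move=> xT; have [sx sy _] := hs x xT.
  have -> : zip y x = map (fun t => (fY t, t.2)) (s x) by rewrite -zip_map sx sy.
  rewrite expR_sum big_map !big_seq.
  by apply: eq_bigr => t tx; rewrite lnK // posrE (q_gt0 x).
(* Only an inequality: where [PY P z = 0], division by zero makes the sum 0. *)
have qsum z : \sum_b q (z, b) <= 1.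
  rewrite /q /= -mulr_suml -/(PY P z).
  by have [->|zn0] := eqVneq (PY P z) 0; rewrite ?mul0r // divff.
have hsum : \sum_(x in T) expR (a x) <= 1.
  apply: (@le_trans _ _ (\sum_(x : n.-tuple bool) \prod_(p <- zip y x) q p)).
    rewrite big_mkcond; apply: ler_sum => x _; case: ifP => [/ea -> //|_].
    exact: prodr_ge0.
  rewrite sum_tuple_prod_zip; apply: prodr_ile1 => z _.
  by rewrite qsum sumr_ge0.
(* [a x] is linear in the type of [s x], so its mean over [T] is an expectation under the mean type
   itself. *)
have aE : (\sum_(x in T) a x) / #|T|%:R = n%:R * \sum_t P t * ln (q (fY t, t.2)).
  rewrite sum_mean_tp mulrA mulr_sumr; congr (_ / _); apply: eq_bigr => x xT.
  by rewrite sum_tp size_s // mulrC divfK // pnatr_eq0 -lt0n.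
have := card_mul_expR_mean_le1 hsum; rewrite aE => hK.
have ln2 : 0 < ln 2 :> R by rewrite ln_gt0 ?ltr1n.
rewrite /log2; under eq_bigr do rewrite mulrA.
rewrite -mulr_suml -mulNr mulrA ler_pM2r ?invr_gt0 // mulrN.
rewrite -[leRHS]expRK ler_ln ?posrE ?ltr0n ?expR_gt0 // expRN.
by rewrite -[leRHS]mul1r ler_pdivlMr ?expR_gt0.
Qed.

(** * Events and union bounds for countably valued random variables *)

Lemma measurable_countable_fibers (d : measure_display) (Omega : measurableType d)
    (T : countType) (Z : Omega -> T) :
  (forall t, measurable [set w | Z w = t]) ->
  forall A : set T, measurable [set w | A (Z w)].
Proof.
move=> mZ A.
have -> : [set w | A (Z w)] = \bigcup_t [set w | Z w = t /\ A t].
  apply/seteqP; split=> w /=; first by exists (Z w).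
  by case=> t _ [->].
apply: countable_bigcupT_measurable => // t.
have [At|nAt] := pselect (A t).
  rewrite (_ : [set w | _] = [set w | Z w = t]) //.
  by apply/seteqP; split=> w /=; [case|].
by rewrite (_ : [set w | _] = set0) //; apply/seteqP; split=> w //= -[].
Qed.

(** Total probability with the conditional bound in product form, so fibres of probability 0 need no
    separate case. The map [pickle] indexes the fibres by natural numbers for countable
    additivity. *)
Lemma probability_le_fibers (R : realType) (d : measure_display)
    (Omega : measurableType d) (Pr : probability Omega R) (T : countType)
    (Z : Omega -> T) (B : set Omega) (eta : R) :
  0 <= eta -> (forall t, measurable [set w | Z w = t]) -> measurable B ->
  (forall t, (Pr (B `&` [set w | Z w = t]) <= eta%:E * Pr [set w | Z w = t])%E) ->
  (Pr B <= eta%:E)%E.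
Proof.
move=> eta0 mZ mB hB.
pose F k := [set w | pickle (Z w) = k].
have mF k : measurable (F k) by exact: (measurable_countable_fibers mZ (fun t => pickle t = k)).
have tF : trivIset setT F by move=> i j _ _ [w [/= <- <-]].
have UF : \bigcup_k F k = setT by apply/seteqP; split=> // w _; exists (pickle (Z w)).
have -> : B = \bigcup_k (B `&` F k) by rewrite -setI_bigcupr UF setIT.
rewrite measure_semi_bigcup //; first last.
- by rewrite -setI_bigcupr UF setIT.
- by apply: trivIset_setIl.
- by move=> k; exact: measurableI.
apply: (@le_trans _ _ (\sum_(0 <= k <oo) eta%:E * Pr (F k))%E).
  apply: lee_nneseries => // k _.
  have [[t kt]|nt] := pselect (exists t : T, pickle t = k).
    have -> : F k = [set w | Z w = t].
      apply/seteqP; split=> w; rewrite /F /= -kt; last by move->.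
      exact: (pcan_inj (@pickleK T)).
    exact: hB.
  have -> : F k = set0 by apply/seteqP; split=> w //= Fw; apply: nt; exists (Z w).
  by rewrite setI0 !measure0 mule0.
rewrite nneseriesZl // -measure_semi_bigcup //; last by rewrite UF.
by rewrite UF [X in (_ * X)%E](probability_setT Pr) mule1.
Qed.

Lemma measure_le_fin_cover (R : realType) (d : measure_display)
    (Omega : measurableType d) (mu : {measure set Omega -> \bar R})
    (I : finType) (P : pred I) (E : I -> set Omega) (B : set Omega) :
  measurable B -> (forall i, measurable (E i)) ->
  (forall w, B w -> exists2 i, P i & E i w) ->
  (mu B <= \sum_(i | P i) mu (E i))%E.
Proof.
move=> mB mE BE.
have mU (r : seq I) : measurable (\big[setU/set0]_(i <- r | P i) E i).
  exact: bigsetU_measurable.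
apply: (@le_trans _ _ (mu (\big[setU/set0]_(i | P i) E i))).
  apply: le_measure; rewrite ?inE //.
  by move=> w /BE[i Pi Ei]; rewrite (bigD1 i) //=; left.
elim: (index_enum I) => [|i r IH]; first by rewrite !big_nil measure0.
rewrite !big_cons; case: ifP => // _.
by apply: le_trans (measureU2 _ _ _) _ => //; rewrite leeD2l.
Qed.

(** * Probabilities of violating the two constraints *)

Lemma inP2_tp_zip (R : realType) (L : nat) (xi : 'I_L.+1 -> bool -> R) (d : R)
    (s : seq ('I_L.+1 * bool)) (x : seq bool) : size x = size s ->
  inP2 xi d [ffun t => tp R (zip s x) t] <->
  (\sum_(t <- zip s x) ((t.2 : nat)%:R - cc R L t.1.1 t.1.2) * xi t.1.1 t.1.2) / (size s)%:R
  <= d / 3 + Num.sqrt ((d / 3) ^+ 2 + 2 * d *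
       ((\sum_(a <- s) cc R L a.1 a.2 * (1 - cc R L a.1 a.2) * xi a.1 a.2 ^+ 2) / (size s)%:R)).
Proof.
move=> xs; rewrite /inP2.
rewrite (sum_margMU _ (fun M U => cc R L M U * (1 - cc R L M U) * xi M U ^+ 2)) /=.
have zs : size (zip s x) = size s by rewrite size_zip xs minnn.
under eq_bigr do rewrite ffunE.
under [X in Num.sqrt (_ + _ * X)]eq_bigr do rewrite ffunE.
rewrite !sum_tp zs.
have -> : \sum_(a <- s) cc R L a.1 a.2 * (1 - cc R L a.1 a.2) * xi a.1 a.2 ^+ 2 =
   \sum_(t <- zip s x) cc R L t.1.1 t.1.2 * (1 - cc R L t.1.1 t.1.2) * xi t.1.1 t.1.2 ^+ 2.
  by rewrite -{1}(@unzip1_zip _ _ s x) ?xs // big_map.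
by [].
Qed.

Lemma probability_not_inP1 (R : realType) (d : measure_display) (Omega : measurableType d)
    (Pr : probability Omega R) (L n : nat) (p q : R)
    (v : Omega -> {ffun 'I_L.+1 -> nat}) (nu : 'I_L.+1 -> R) (delta eta : R) :
  (forall w, (\sum_(M : 'I_L.+1) v w M)%N = n) ->
  (forall vv, measurable [set w | v w = vv]) ->
  (forall vv : {ffun 'I_L.+1 -> nat}, (\sum_(M : 'I_L.+1) vv M)%N = n ->
     Pr [set w | v w = vv] =
     (n`!%:R / (\prod_(M : 'I_L.+1) (vv M)`!)%:R * \prod_(M : 'I_L.+1) binom L q M ^+ vv M)%:E) ->
  0 <= q <= p -> p <= 1 -> (forall M, 0 <= nu M) ->
  (forall M : 'I_L.+1, M%:R < L%:R * p -> nu M = 0) -> 0 <= delta -> 0 <= eta ->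
  (forall Q : {ffun 'I_L.+1 -> R}, isPM Q ->
     Ebin p nu + delta <= \sum_M Q M * nu M ->
     pow2neg (n%:R%:E * KL Q (binom L p))%E <= eta) ->
  (Pr [set w | (n%:R * (Ebin p nu + delta) < \sum_M (v w M)%:R * nu M)%R] <= eta%:E)%E.
Proof.
move=> hv mv hA q0p p1 nu0 nuS d0 eta0 hmax.
have := multinomial_tail_KL q0p p1 nu0 nuS d0 eta0 hmax; rewrite -lee_fin; apply: le_trans.
rewrite -sumEFin.
pose c (f : {ffun 'I_L.+1 -> 'I_n.+1}) : {ffun 'I_L.+1 -> nat} := [ffun M => nat_of_ord (f M)].
have cE f M : c f M = f M by rewrite ffunE.
have mB : measurable [set w | n%:R * (Ebin p nu + delta) < \sum_M (v w M)%:R * nu M].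
  exact: (measurable_countable_fibers mv
    (fun vv : {ffun 'I_L.+1 -> nat} => n%:R * (Ebin p nu + delta) < \sum_M (vv M)%:R * nu M)).
rewrite (eq_bigr (fun f => Pr [set w | v w = c f])); last first.
  move=> f /andP[/eqP fn _]; rewrite hA; last by under eq_bigr do rewrite cE.
  by congr ((_ / _%:R * _)%:E); apply: eq_bigr => M _; rewrite cE.
apply: measure_le_fin_cover => // w /= hw.
(* The counts sum to [n], so each fits into the finite index type of the multinomial sum. *)
have vn M : (v w M < n.+1)%N by rewrite ltnS -(hv w) (bigD1 M) //= leq_addr.
exists [ffun M => Ordinal (vn M)].
  apply/andP; split; first by rewrite -[X in _ == X](hv w); apply/eqP/eq_bigr => M _; rewrite ffunE.
  by apply: (lt_le_trans hw); rewrite le_eqVlt; apply/orP; left; apply/eqP/eq_bigr => M _; rewrite ffunE.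
by apply/ffunP => M; rewrite cE ffunE.
Qed.

Lemma probability_not_inP2 (R : realType) (d : measure_display) (Omega : measurableType d)
    (Pr : probability Omega R) (L : nat) (N : Omega -> nat)
    (ms : Omega -> seq 'I_L.+1) (us xs : Omega -> seq bool)
    (xi : 'I_L.+1 -> bool -> R) (eta : R) (delta : nat -> R) :
  (2 <= L)%N ->
  (forall w, (1 <= N w)%N ->
     [/\ size (ms w) = N w, size (us w) = N w, size (xs w) = N w
       & all (@inW L) (trip (ms w) (us w) (xs w))]) ->
  (forall t, measurable [set w | (N w, ms w, us w) = t]) ->
  (forall s, measurable [set w | xs w = s]) ->
  (forall (n : nat) (m : seq 'I_L.+1) (u x : seq bool), (1 <= n)%N ->
     size m = n -> size u = n -> size x = n ->
     Pr [set w | [/\ N w = n, ms w = m, us w = u & xs w = x]] =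
     (Pr [set w | [/\ N w = n, ms w = m & us w = u]] *
      (\prod_(t <- trip m u x)
         (cc R L t.1.1 t.1.2 ^+ t.2 * (1 - cc R L t.1.1 t.1.2) ^+ (1 - t.2)))%:E)%E) ->
  (forall (M : 'I_L.+1) (U : bool), 0 <= cc R L M U <= 1 -> `|xi M U| <= 1) ->
  0 <= eta ->
  (forall n : nat, (1 <= n)%N -> 0 <= delta n /\ expR (- (n%:R * delta n)) <= eta) ->
  measurable [set w | (1 <= N w)%N /\
    ~ inP2 xi (delta (N w)) [ffun t => tp R (trip (ms w) (us w) (xs w)) t]] ->
  (Pr [set w | (1 <= N w)%N /\
    ~ inP2 xi (delta (N w)) [ffun t => tp R (trip (ms w) (us w) (xs w)) t]] <= eta%:E)%E.
Proof.
move=> L2 hseq mZ mx hC hxi eta0 hdelta mB.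
apply: (probability_le_fibers eta0 mZ mB) => -[[n m] u].
set B := (X in X `&` _); set Zt := [set w | _ = _].
(* A fibre that misses [N >= 1] does not meet the event. Otherwise a point [w0] of it supplies the
   lengths of [m] and [u], and its triples in [inW] place every [c(m_k, u_k)] in [0, 1]. *)
have [[w0 [w0N /= [Nw0 mw0 uw0]]]|noB] := pselect (exists w, (1 <= N w)%N /\ Zt w); last first.
  rewrite (_ : B `&` Zt = set0) ?measure0 ?mule_ge0 ?lee_fin //.
  by apply/seteqP; split=> w //= -[[wN _] Zw]; apply: noB; exists w.
have [] := hseq w0 w0N; rewrite mw0 uw0 Nw0 => sm su sx0 inW0.
have n1 : (1 <= n)%N by rewrite -Nw0.
pose s := zip m u.
have ss : size s = n by rewrite size_zip sm su minnn.
have sn0 : s != [::] by rewrite -size_eq0 ss -lt0n.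
have hs : {in s, forall a : 'I_L.+1 * bool, 0 <= cc R L a.1 a.2 <= 1 /\ `|xi a.1 a.2| <= 1}.
  move=> a; rewrite -(@unzip1_zip _ _ s (xs w0)) ?ss ?sx0 // => /mapP[t ts ->].
  have ct := cc_inW R L2 (allP inW0 _ ts).
  by split => //; exact: hxi.
have [d0 hexp] := hdelta n n1.
have := Bernstein_tail sn0 d0 hs; rewrite ss => /le_trans /(_ hexp).
set bad := (X in \sum_(x | X x) _); set wt := (X in \sum_(x | _) X x) => hBt.
have mZt : measurable Zt by exact: mZ.
have ZtE : Zt = [set w | [/\ N w = n, ms w = m & us w = u]].
  by apply/seteqP; rewrite /Zt; split=> w /= [-> -> ->].
apply: (@le_trans _ _ (\sum_(x : n.-tuple bool | bad x) Pr (Zt `&` [set w | xs w = x]))%E).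
  apply: measure_le_fin_cover => [|x|w [[wN nP2] [Nw mw uw]]].
  - exact: measurableI.
  - exact: measurableI.
  have [_ _ sx _] := hseq w wN.
  have sxn : size (xs w) == n by rewrite sx Nw.
  exists (Tuple sxn); last by split; rewrite /Zt /= ?Nw ?mw ?uw.
  rewrite /bad; apply/negP => le_x; apply: nP2.
  by rewrite Nw mw uw /trip inP2_tp_zip ?ss ?(eqP sxn).
rewrite (eq_bigr (fun x => (fine (Pr Zt) * wt x)%:E)); last first.
  move=> x _; rewrite EFinM fineK ?fin_num_measure // ZtE.
  rewrite (_ : _ `&` _ = [set w | [/\ N w = n, ms w = m, us w = u & xs w = x]]).
    by rewrite hC ?size_tuple.
  by apply/seteqP; split=> w /= [[-> -> ->]] // ->.
rewrite sumEFin -mulr_sumr -[Pr Zt]fineK ?fin_num_measure // -EFinM lee_fin mulrC.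
by rewrite ler_wpM2r ?fine_ge0 // lee_fin fine_ge0.
Qed.

(** * Construction of the sets [T], their size, and the covering of the failure event *)

Unset Implicit Arguments.

Theorem theorem1 (R : realType) (d : measure_display) (Omega : measurableType d)
  (Pr : probability Omega R)
  (L Nem : nat) (psrc : R)
  (hL : (2 <= L)%N) (hNem : (1 <= Nem)%N) (hpsrc : 0 <= psrc <= 1)
  (* random variables *)
  (v : Omega -> {ffun 'I_L.+1 -> nat}) (N : Omega -> nat)
  (ms : Omega -> seq 'I_L.+1) (us xs : Omega -> seq bool)
  (hv : forall w, (\sum_(M : 'I_L.+1) v w M)%N = Nem)
  (hseq : forall w, (1 <= N w)%N ->
     [/\ size (ms w) = N w, size (us w) = N w, size (xs w) = N w
       & all (@inW L) (trip (ms w) (us w) (xs w))])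
  (mv : forall vv, measurable [set w | v w = vv])
  (mN : forall n, measurable [set w | N w = n])
  (mm : forall s, measurable [set w | ms w = s])
  (mu : forall s, measurable [set w | us w = s])
  (mx : forall s, measurable [set w | xs w = s])
  (* (A) *)
  (hA : exists podd : R, 0 <= podd <= psrc /\
     forall vv : {ffun 'I_L.+1 -> nat}, (\sum_(M : 'I_L.+1) vv M)%N = Nem ->
       Pr [set w | v w = vv] =
       ((Nem`!)%:R / (\prod_(M : 'I_L.+1) (vv M)`!)%:R * \prod_(M : 'I_L.+1) binom L podd M ^+ vv M)%:E)
  (* (B) *)
  (hB : forall M : 'I_L.+1,
     Pr [set w | (1 <= N w)%N /\ (N w)%:R * tp R (ms w) M <= (v w M)%:R]
     = Pr [set w | (1 <= N w)%N])
  (* (C) *)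
  (hC : forall (n : nat) (m : seq 'I_L.+1) (u x : seq bool), (1 <= n)%N ->
     size m = n -> size u = n -> size x = n ->
     Pr [set w | [/\ N w = n, ms w = m, us w = u & xs w = x]] =
     (Pr [set w | [/\ N w = n, ms w = m & us w = u]] *
      (\prod_(t <- trip m u x)
         (cc R L t.1.1 t.1.2 ^+ t.2 * (1 - cc R L t.1.1 t.1.2) ^+ (1 - t.2)))%:E)%E)
  (* constants nu, xi *)
  (nu : 'I_L.+1 -> R) (hnu0 : forall M, 0 <= nu M)
  (hnu : forall M : 'I_L.+1, (M%:R < L%:R * psrc) -> nu M = 0)
  (xi : 'I_L.+1 -> bool -> R)
  (hxi : forall (M : 'I_L.+1) (U : bool), 0 <= cc R L M U <= 1 -> `|xi M U| <= 1)
  (eta1 delta1 : R) (heta1 : 0 <= eta1) (hdelta1 : 0 <= delta1)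
  (hmax1 : forall Q : {ffun 'I_L.+1 -> R}, isPM Q ->
     \sum_(M : 'I_L.+1) Q M * nu M >= Ebin psrc nu + delta1 ->
     pow2neg ((Nem%:R)%:E * KL Q (binom L psrc))%E <= eta1)
  (eta2 : R) (heta2 : 0 <= eta2) (delta2 : nat -> R)
  (hdelta2 : forall n : nat, (1 <= n)%N -> 0 <= delta2 n /\ expR (- (n%:R * delta2 n)) <= eta2)
  (HPA : nat -> R)
  (hHPA : forall n : nat, (1 <= n)%N -> forall P : {ffun Tri L -> R},
     isPW P -> inP1 Nem n psrc nu delta1 P -> inP2 xi (delta2 n) P ->
     condH P <= HPA n) :
  exists T : forall n : nat, seq (nat * bool) -> {set n.-tuple bool},
    (Pr [set w | (1 <= N w)%N /\
        ~ (exists t : (N w).-tuple bool,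
             t \in T (N w) (map (@fY L) (trip (ms w) (us w) (xs w)))
             /\ tval t = xs w)]
      <= (eta1 + eta2)%:E)%E
    /\ forall (n : nat) (y : seq (nat * bool)), (1 <= n)%N -> size y = n ->
         all (inY L) y ->
         (#|T n y| == 0)%N \/ log2 (R:=R) (#|T n y|)%:R <= n%:R * HPA n.
Proof.
have /andP[_ p1] := hpsrc.
pose ty (s : seq (Tri L)) : {ffun Tri L -> R} := [ffun t => tp R s t].
pose E n P := inP1 Nem n psrc nu delta1 P /\ inP2 xi (delta2 n) P.
pose T n (y : seq (nat * bool)) := [set x : n.-tuple bool | `[< exists s : seq (Tri L),
  [/\ map snd s = x, map (@fY L) s = y, all (@inW L) s & E n (ty s)] >]]%SET.
exists T; split; last first.
  move=> n y n1 yn _; have [->|Tn0] := eqVneq #|T n y| 0%N; [by left|right].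
  case: n / yn in n1 Tn0 *.
  have hT x : exists s : seq (Tri L), x \in T (size y) y ->
      [/\ map snd s = x, map (@fY L) s = y, all (@inW L) s & E (size y) (ty s)].
    have [|xT] := boolP (x \in T (size y) y); last by exists [::].
    by rewrite inE => /asboolP[s hs]; exists s.
  have [s hs] := boolp.choice hT.
  have T0 : (0 < #|T (size y) y|)%N by rewrite lt0n.
  have s_inW x : x \in T (size y) y -> all (@inW L) (s x) by move=> /hs[].
  have size_s x : x \in T (size y) y -> size (s x) = size y.
    by move=> /hs[_ <- _ _]; rewrite size_map.
  apply: le_trans (log2_card_le_condH R (s := s) hL n1 T0 _) _.
    by move=> x /hs[sx sy sW _]; split.
  rewrite ler_wpM2l //; apply: hHPA => //.
  - exact: mean_tp_isPW size_s s_inW.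
  - by apply: mean_tp_inP1 => // x /hs[_ _ _ []].
  - have [d0 _] := hdelta2 _ n1.
    by apply: mean_tp_inP2 => // x /hs[_ _ _ []].
have [podd [podd01 hmult]] := hA.
(* All variables are bundled into one with countable range, so that every event below is
   measurable. *)
pose Z w := (v w, N w, ms w, us w, xs w).
have mZ t : measurable [set w | Z w = t].
  case: t => -[[[v' n'] m'] u'] x'.
  rewrite (_ : [set w | _] = [set w | v w = v'] `&` [set w | N w = n'] `&` [set w | ms w = m']
     `&` [set w | us w = u'] `&` [set w | xs w = x']).
    by do !apply: measurableI.
  by apply/seteqP; rewrite /Z; split=> w /=; [case=> -> -> -> -> ->|case=> -[[[-> ->] ->] ->] ->].
have mA := measurable_countable_fibers mZ.
pose B1 := [set w | Nem%:R * (Ebin psrc nu + delta1) < \sum_M (v w M)%:R * nu M].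
pose B2 := [set w | (1 <= N w)%N /\ ~ inP2 xi (delta2 (N w)) (ty (trip (ms w) (us w) (xs w)))].
(* The failure of (B) at [M], a null event. *)
pose B0 M := [set w | (1 <= N w)%N /\ ~ (N w)%:R * tp R (ms w) M <= (v w M)%:R].
have mB1 : measurable B1.
  exact: (mA (fun z => Nem%:R * (Ebin psrc nu + delta1) < \sum_M (z.1.1.1.1 M)%:R * nu M)).
have mB2 : measurable B2.
  exact: (mA (fun z => (1 <= z.1.1.1.2)%N /\
    ~ inP2 xi (delta2 z.1.1.1.2) (ty (trip z.1.1.2 z.1.2 z.2)))).
have mN1 : measurable [set w | (1 <= N w)%N].
  exact: (mA (fun z => (1 <= z.1.1.1.2)%N)).
have mB0' M : measurable [set w | (1 <= N w)%N /\ (N w)%:R * tp R (ms w) M <= (v w M)%:R].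
  exact: (mA (fun z => (1 <= z.1.1.1.2)%N /\ z.1.1.1.2%:R * tp R z.1.1.2 M <= (z.1.1.1.1 M)%:R)).
have mB0 M : measurable (B0 M).
  exact: (mA (fun z => (1 <= z.1.1.1.2)%N /\ ~ z.1.1.1.2%:R * tp R z.1.1.2 M <= (z.1.1.1.1 M)%:R)).
have PB1 : (Pr B1 <= eta1%:E)%E by exact: (probability_not_inP1 hv mv hmult).
have PB2 : (Pr B2 <= eta2%:E)%E.
  apply: (probability_not_inP2 hL hseq _ mx hC hxi heta2 hdelta2 mB2) => t.
  exact: (mA (fun z => (z.1.1.1.2, z.1.1.2, z.1.2) = t)).
have PB0 M : Pr (B0 M) = 0%E.
  rewrite (_ : B0 M = [set w | (1 <= N w)%N] `\` [set w | (1 <= N w)%N /\ (N w)%:R * tp R (ms w) M <= (v w M)%:R]); last first.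
    by apply/seteqP; split=> w /= [wN h]; split=> // h'; apply: h => //; case: h'.
  rewrite measureD //; last by rewrite (le_lt_trans (probability_le1 _ _)) ?ltry.
  rewrite setIidr; last by move=> w [].
  by rewrite [X in (_ - X)%E](hB M) subee // fin_num_measure.
pose B0U := [set w | exists2 M, xpredT M & B0 M w].
have mB0U : measurable B0U.
  exact: (mA (fun z => exists2 M, xpredT M & (1 <= z.1.1.1.2)%N /\
    ~ z.1.1.1.2%:R * tp R z.1.1.2 M <= (z.1.1.1.1 M)%:R)).
have PB0U : Pr B0U = 0%E.
  apply/eqP; rewrite eq_le measure_ge0 andbT.
  apply: (le_trans (measure_le_fin_cover Pr mB0U mB0 (fun w h => h))).
  by rewrite big1 // => M _; exact: PB0.
set B := (X in (Pr X <= _)%E).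
have mB : measurable B.
  exact: (mA (fun z => (1 <= z.1.1.1.2)%N /\
        ~ (exists t : (z.1.1.1.2).-tuple bool,
             t \in T z.1.1.1.2 (map (@fY L) (trip z.1.1.2 z.1.2 z.2))
             /\ tval t = z.2))).
have BU : B `<=` B1 `|` B2 `|` B0U.
  move=> w [wN nT]; apply: contrapT => nU; apply: nT.
  have [sm su sx sW] := hseq w wN.
  have n1 : ~ B1 w by move=> h; apply: nU; left; left.
  have n2 : ~ B2 w by move=> h; apply: nU; left; right.
  have n0 M : ~ B0 M w by move=> h; apply: nU; right; exists M.
  have sxt : size (xs w) == N w by rewrite sx.
  have sz : size (zip (ms w) (us w)) = N w by rewrite size_zip sm su minnn.
  exists (Tuple sxt); split=> //; rewrite inE; apply/asboolP.
  exists (trip (ms w) (us w) (xs w)); split=> //.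
    by rewrite -/unzip2 unzip2_zip ?sz ?sx.
  split; last by apply: contrapT => h; apply: n2.
  rewrite /inP1 sum_margM.
  under eq_bigr do rewrite ffunE.
  have N0 : 0 < (N w)%:R :> R by rewrite ltr0n.
  rewrite sum_tp {2}/trip size_zip sz sx minnn.
  rewrite -(big_map (fun t : Tri L => t.1.1) xpredT nu).
  have -> : map (fun t : Tri L => t.1.1) (trip (ms w) (us w) (xs w)) = ms w.
    rewrite (map_comp fst fst) -[map fst (trip _ _ _)]/(unzip1 _) unzip1_zip ?sz ?sx //.
    by rewrite -/unzip1 unzip1_zip ?sm ?su.
  rewrite -[in leLHS]sm -sum_tp -(ler_pM2l N0) [leRHS]mulrA [_ * (Nem%:R / _)]mulrC divfK ?gt_eqF //.
  (* Outside the null events [N * tp] is at most [v] coordinatewise. As [nu] is non-negative, the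
     bound on [\sum_M v M * nu M] outside [B1] passes to the type. *)
  apply: (@le_trans _ _ (\sum_M (v w M)%:R * nu M)).
    rewrite mulr_sumr; apply: ler_sum => M _; rewrite mulrA ler_wpM2r //.
    by apply: contrapT => h; apply: (n0 M).
  by rewrite leNgt; apply/negP.
apply: (@le_trans _ _ (Pr (B1 `|` B2 `|` B0U))).
  by apply: le_measure; rewrite ?inE //; do !apply: measurableU.
rewrite measureU0 //; last exact: measurableU.
by rewrite EFinD (le_trans (measureU2 _ _ _)) // leeD.
Qed.
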